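(* Let $(X_N)_{N\in\mathbb{N}}$ be a self-adjoint random matrix ensemble and let $M>0$, $K>0$ be constants such that: (i) for all $m,n\in\mathbb{N}$ the limits $\alpha_n=\lim_{N\to\infty}\frac1N\mathbb{E}(\mathrm{Tr}(X_N^n))$ and $\alpha_{m,n}=\lim_{N\to\infty}\mathrm{Cov}(\mathrm{Tr}(X_N^m),\mathrm{Tr}(X_N^n))$ exist; (ii) $\lim_{N\to\infty}N^8\,\mathbb{P}(\|X_N\|>M)=0$; (iii) for all $f\in C^1(\mathbb{R})$ and $N\in\mathbb{N}$, $\mathrm{Var}(\mathrm{Tr}(f(X_N)))\le K\|f'\|_\infty^2$. Let $\rho$ be the associated asymptotic covariance map on $C^1([-M,M])\times C^1([-M,M])$, and let $G_2(z,w)=\sum_{m,n\ge1}\frac{\alpha_{m,n}}{z^{m+1}w^{n+1}}$ for $|z|,|w|>M$. Then $G_2$ can be analytically extended to $(\mathbb{C}\setminus[-M,M])^2$ and (for this extension), for all $z,w\in\mathbb{C}\setminus\mathbb{R}$, $$G_2(z,w)=\rho(r_z,r_w),$$ where $r_z(x)=\frac1{z-x}$ (restricted to $[-M,M]$ as an argument of $\rho$).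
   Context: A self-adjoint random matrix ensemble $(X_N)_{N}$ is a sequence in which $X_N$ is an $N\times N$ self-adjoint complex random matrix; all moments $\mathbb{E}(\mathrm{Tr}(X_N^n))$ and covariances $\mathrm{Cov}(\mathrm{Tr}(X_N^m),\mathrm{Tr}(X_N^n))$ are assumed finite. $\|X_N\|$ is the operator norm; $\mathrm{Tr}$ is the unnormalized trace; $\mathrm{Tr}(f(X_N))=\sum_k f(\lambda_k)$, with $\lambda_1,\dots,\lambda_N$ the eigenvalues of $X_N$. $\mathrm{Cov}(X,Y)=\mathbb{E}(XY)-\mathbb{E}(X)\mathbb{E}(Y)$ (no complex conjugation) and $\mathrm{Var}(X)=\mathbb{E}|X-\mathbb{E}X|^2$ for complex random variables. $C^1(\mathbb{R})$ is the space of complex-valued functions on $\mathbb{R}$ with continuous derivative; $C^1([-M,M])$ is the space of restrictions of such functions to $[-M,M]$; $\|h\|_M=\sup_{|x|\le M}|h(x)|$; $\|h\|_\infty=\sup_{x\in\mathbb{R}}|h(x)|$. The asymptotic covariance map $\rho:C^1([-M,M])\times C^1([-M,M])\to\mathbb{C}$ is the unique bilinear map such that $\rho(x^m,x^n)=\alpha_{m,n}$ for $m,n\ge1$, $\rho(1,f)=\rho(f,1)=0$ for all $f$, and $|\rho(f,g)|\le K\|f'\|_M\|g'\|_M$ for all $f,g\in C^1([-M,M])$ (it is obtained by continuous extension from polynomials, which are dense). In particular $|\alpha_{m,n}|\le KmnM^{m+n-2}$, so the series defining $G_2$ (the second-order Cauchy transform) converges to an analytic function on $\{(z,w)\in\mathbb{C}^2:|z|,|w|>M\}$.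 *)

(* Defs.v *)
From HB Require Import structures.
From mathcomp Require Import all_boot all_order all_algebra.
From mathcomp Require Import complex.
From mathcomp Require Import all_classical all_reals all_analysis.
From mathcomp.analysis.showcase Require Import summability.

Set Implicit Arguments.
Unset Strict Implicit.
Unset Printing Implicit Defensive.

Import Order.TTheory GRing.Theory Num.Theory.
Import numFieldNormedType.Exports complex.

Local Open Scope classical_set_scope.
Local Open Scope ring_scope.
Local Open Scope complex_scope.
Import Normc.

(* The usual topology of the complex numbers, given by the modulus. *)
HB.instance Definition _ (R : realType) := NormedModule.copy R[i] R[i]^o.

Section Calculus.
Context {R : realType}.
Implicit Types (M : R) (f g h : R -> R[i]).

Definition cderiv f : R -> R[i] :=
  fun x => derive1 (fun y => Re (f y)) x +i* derive1 (fun y => Im (f y)) x.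

Definition C1 : set (R -> R[i]) := [set f |
  [/\ forall x : R, derivable (fun y => Re (f y)) x 1,
      forall x : R, derivable (fun y => Im (f y)) x 1,
      continuous (derive1 (fun y => Re (f y))) &
      continuous (derive1 (fun y => Im (f y)))]].

Definition sup_norm_on M h : R := sup [set normc (h x) | x in `[- M, M]].

(* Extended-real valued, since h may be unbounded. *)
Definition sup_norm h : \bar R := ereal_sup [set (normc (h x))%:E | x in setT].

(* The restriction of f to [-M, M], encoded as the function that is f on
   [-M, M] and 0 elsewhere: two restrictions are equal iff the functions
   agree on [-M, M]. *)
Definition restr M f : R -> R[i] := patch (fun=> 0) `[- M, M] f.

Definition C1_itv M : set (R -> R[i]) := restr M @` C1.

Definition resolvent (z : R[i]) : R -> R[i] := fun x => (z - x%:C)^-1.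

Definition real_segment M : set R[i] := [set x%:C | x in `[- M, M]].

(* Unordered (equivalently, absolutely convergent) summation of a double
   family. *)
Definition has_double_sum (u : nat -> nat -> R[i]) (s : R[i]) : Prop :=
  partial_sum (fun p : nat * nat => u p.1 p.2) @ totally --> s.

Definition analytic2_at (F : R[i] -> R[i] -> R[i]) (z0 w0 : R[i]) : Prop :=
  exists (c : nat -> nat -> R[i]) (r : R), 0 < r /\
    forall z w : R[i], normc (z - z0) < r -> normc (w - w0) < r ->
      has_double_sum (fun j k => c j k * (z - z0) ^+ j * (w - w0) ^+ k) (F z w).

End Calculus.

Section RandomMatrices.
Context {R : realType}.

Definition l2norm n (v : 'cV[R[i]]_n) : R :=
  Num.sqrt (\sum_i normc (v i 0) ^+ 2).

Definition opnorm n (A : 'M[R[i]]_n) : R :=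
  sup [set l2norm (A *m v) | v in [set v | l2norm v <= 1]].

(* Tr (f(A)) for self-adjoint A: the spectral theorem provides the row
   spectral_diag A of the eigenvalues of A, with multiplicity; they are real. *)
Definition trace_fun n (f : R -> R[i]) (A : 'M[R[i]]_n) : R[i] :=
  \sum_(k < n) f (Re (spectral_diag A 0 k)).

Context {d : measure_display} {T : measurableType d} (P : probability T R).
Implicit Types Y Z : T -> R[i].

Definition cintegrable Z : Prop :=
  P.-integrable setT (fun t => (Re (Z t))%:E) /\
  P.-integrable setT (fun t => (Im (Z t))%:E).

Definition cexpectation Z : R[i] :=
  fine ('E_P[fun t => Re (Z t)])%E +i* fine ('E_P[fun t => Im (Z t)])%E.

Definition ccovariance Y Z : R[i] :=
  cexpectation (fun t => Y t * Z t) - cexpectation Y * cexpectation Z.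

(* The value is meaningful when Z is integrable.  For Z = Tr (f(X)) with X
   square-integrable this holds as soon as f' is bounded, so a bound of the
   variance by a multiple of sup_norm f' ^ 2 never involves a junk value:
   it is trivial when sup_norm f' = +oo. *)
Definition cvariance Z : \bar R :=
  (\int[P]_t (normc (Z t - cexpectation Z) ^+ 2)%:E)%E.

Record selfadjoint_random_matrix n (X : T -> 'M[R[i]]_n) : Prop := {
  srm_measurable_re : forall i j, measurable_fun setT (fun t => Re (X t i j));
  srm_measurable_im : forall i j, measurable_fun setT (fun t => Im (X t i j));
  srm_selfadjoint : forall t, X t \is hermsymmx;
  srm_moments : forall k, cintegrable (fun t => \tr (X t ^+ k));
  srm_covariances : forall k l,
    cintegrable (fun t => \tr (X t ^+ k) * \tr (X t ^+ l))
}.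

End RandomMatrices.

Section SecondOrder.
Context {R : realType}.
Implicit Types (M K : R) (alpha : nat -> nat -> R[i]).

(* rho is only meaningful on C1_itv M.  In acm_bound the arguments of rho are
   the restrictions of f and g, whose derivatives on [-M, M] (one-sided at the
   endpoints) are those of f and g. *)
Record asymptotic_covariance_map M K alpha
    (rho : (R -> R[i]) -> (R -> R[i]) -> R[i]) : Prop := {
  acm_linearl : forall (a : R[i]) f1 f2 g,
    C1_itv M f1 -> C1_itv M f2 -> C1_itv M g ->
    rho (fun x => a * f1 x + f2 x) g = a * rho f1 g + rho f2 g;
  acm_linearr : forall (a : R[i]) f g1 g2,
    C1_itv M f -> C1_itv M g1 -> C1_itv M g2 ->
    rho f (fun x => a * g1 x + g2 x) = a * rho f g1 + rho f g2;
  acm_monomials : forall m n, (0 < m)%N -> (0 < n)%N ->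
    rho (restr M (fun x => x%:C ^+ m)) (restr M (fun x => x%:C ^+ n))
      = alpha m n;
  acm_1l : forall f, C1_itv M f -> rho (restr M (fun=> 1)) f = 0;
  acm_1r : forall f, C1_itv M f -> rho f (restr M (fun=> 1)) = 0;
  acm_bound : forall f g, C1 f -> C1 g ->
    normc (rho (restr M f) (restr M g))
      <= K * sup_norm_on M (cderiv f) * sup_norm_on M (cderiv g)
}.

(* s is the sum, over m, n >= 1, of alpha m n / (z^(m+1) w^(n+1)); the indices
   m and n below start from 0. *)
Definition second_order_cauchy alpha (z w s : R[i]) : Prop :=
  has_double_sum
    (fun m n => alpha m.+1 n.+1 / (z ^+ m.+2 * w ^+ n.+2)) s.

End SecondOrder.

(* Main.v *)
Require Import Defs.
From HB Require Import structures.
From mathcomp Require Import all_boot all_order all_algebra.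
From mathcomp Require Import finmap complex ring lra.
From mathcomp Require Import all_classical all_reals all_analysis.
From mathcomp.analysis.showcase Require Import summability.

Import Order.TTheory GRing.Theory Num.Theory.
Import numFieldNormedType.Exports complex Normc.

Local Open Scope classical_set_scope.
Local Open Scope ring_scope.
Local Open Scope complex_scope.

(* The extension is G2(z, w) := rho(r_z, r_w), which makes sense for all z, w
   outside [-M, M], since r_z is then the restriction of a C^1 function.  If
   r = e + q r on [-M, M] with |q| <= theta < 1 there, then r = \sum_j q^j e,
   and the derivatives of the remainders q^n r decay geometrically on [-M, M];
   the bound on rho thus gives rho(r, r') = \sum_(j, k) rho(q^j e, q'^k e').
   With q = (z0 - z) r_z0 and e = r_z0 this is the Taylor expansion of G2 at a
   point; with q = x / z it is the series of the alpha_(m, n). *)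

(** * Real functions of class C^1 *)

Section RealC1.
Context {R : realType}.
Implicit Types f g df dg : R -> R.

(** The derivative is an explicit parameter, so that each closure rule yields its closed formula,
    from which its continuity is read off. *)
Definition realC1 f df := (forall x : R, is_derive x 1 f (df x)) /\ continuous df.

Lemma realC1_continuous f df : realC1 f df -> continuous f.
Proof.
move=> [Hf _] x; apply/differentiable_continuous/derivable1_diffP.
by have [] := Hf x.
Qed.

Lemma realC1_cst (a : R) : realC1 (fun=> a) (fun=> 0).
Proof.
by split=> x; [exact: (is_derive_cst (V := R^o)) | exact: cvg_cst].
Qed.

Lemma realC1_id : realC1 id (fun=> 1).
Proof. by split=> x; [exact: (is_derive_id (V := R^o)) | exact: cvg_cst]. Qed.

Lemma realC1D f g df dg : realC1 f df -> realC1 g dg ->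
  realC1 (fun x => f x + g x) (fun x => df x + dg x).
Proof.
move=> [Hf Cf] [Hg Cg]; split=> x; first exact: is_deriveD.
by apply: cvgD; [exact: Cf | exact: Cg].
Qed.

Lemma realC1N f df : realC1 f df -> realC1 (fun x => - f x) (fun x => - df x).
Proof.
move=> [Hf Cf]; split=> x; first exact: is_deriveN.
by apply: cvgN; exact: Cf.
Qed.

Lemma realC1M f g df dg : realC1 f df -> realC1 g dg ->
  realC1 (fun x => f x * g x) (fun x => df x * g x + f x * dg x).
Proof.
move=> Hf Hg; have cf := realC1_continuous _ _ Hf.
have cg := realC1_continuous _ _ Hg.
have [[{}Hf Cf] [{}Hg Cg]] := (Hf, Hg); split=> x.
  apply: (is_derive_eq (is_deriveM (Hf x) (Hg x))).
  by rewrite addrC /GRing.scale/= mulrC.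
apply: cvgD; apply: cvgM; [exact: Cf|exact: cg|exact: cf|exact: Cg].
Qed.

Lemma realC1V f df : (forall x, f x != 0) -> realC1 f df ->
  realC1 (fun x => (f x)^-1) (fun x => - (f x) ^- 2 * df x).
Proof.
move=> f0 Hf; have cf := realC1_continuous _ _ Hf.
have [{}Hf Cf] := Hf; split=> x.
  have [dfx <-] := Hf x.
  by apply: DeriveDef; [exact: derivableV | rewrite deriveV].
apply: cvgM; last exact: Cf.
apply: cvgN; apply: cvgV; first by rewrite expf_neq0.
by rewrite expr2; apply: cvgM; exact: cf.
Qed.

Lemma realC1_comp f g df dg : realC1 f df -> realC1 g dg ->
  realC1 (fun x => f (g x)) (fun x => df (g x) * dg x).
Proof.
move=> Hf Hg; have cg := realC1_continuous _ _ Hg.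
have [[{}Hf Cf] [{}Hg Cg]] := (Hf, Hg); split=> x.
  exact: (is_derive1_comp (Hf (g x)) (Hg x)).
by apply: cvgM; [apply: continuous_comp; [exact: cg|exact: Cf] | exact: Cg].
Qed.

(** The squared positive part vanishes exactly on the nonpositive half-line and leaves it with zero
    slope. Composed with x^2 - M^2, it gives the term that keeps extended resolvents finite outside
    [-M, M]. *)
Lemma realC1_sq_max0 : realC1 (fun u => Num.max 0 u ^+ 2) (fun u => 2 * Num.max 0 u).
Proof.
split=> x; last first.
  apply: cvgM; first exact: cvg_cst.
  by apply: continuous_max => //; exact: cvg_cst.
set f := fun u : R => _.
have lim : h^-1 *: (f (h *: 1 + x) - f x) @[h --> (0 : R)^'] -->
    2 * Num.max 0 x.
  apply/cvgrPdist_le => e e0.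
  exists e => //= h; rewrite /ball/= sub0r normrN => he h0.
  rewrite (le_trans _ (ltW he)) // /f /GRing.scale/= mulr1.
  have h1 : 0 < `|h| by rewrite normr_gt0.
  (* After multiplication by |h| the claim is |f(x + h) - f(x) - 2 h max(0, x)| <= h^2, settled by
     the signs of x and x + h. *)
  rewrite -(ler_pM2l h1) -normrM mulrBr mulVKf //.
  rewrite -[leRHS]expr2 real_normK ?num_real//.
  rewrite ler_norml /Num.max; case: ltP => ?; case: ltP => ?; apply/andP; split; nra.
apply: DeriveDef; first by apply/cvg_ex; exists (2 * Num.max 0 x).
exact: cvg_lim lim.
Qed.

End RealC1.

(** * Complex-valued C^1 functions of a real variable *)

Section ComplexC1.
Context {R : realType}.
Implicit Types f g df dg : R -> R[i].

Definition C1_deriv f df :=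
  realC1 (fun x => Re (f x)) (fun x => Re (df x)) /\
  realC1 (fun x => Im (f x)) (fun x => Im (df x)).

Lemma realC1_derive1 (h dh : R -> R) : realC1 h dh -> derive1 h = dh.
Proof.
by move=> [Hh _]; apply/funext => x; rewrite derive1E; have [] := Hh x.
Qed.

Lemma C1_deriv_C1 f df : C1_deriv f df -> C1 f.
Proof.
move=> [Hr Hi]; split.
- by move=> x; case: Hr => /(_ x)[].
- by move=> x; case: Hi => /(_ x)[].
- by rewrite (realC1_derive1 _ _ Hr); case: Hr.
- by rewrite (realC1_derive1 _ _ Hi); case: Hi.
Qed.

Lemma C1_deriv_cderiv f df : C1_deriv f df -> cderiv f = df.
Proof.
move=> [Hr Hi]; apply/funext => x; rewrite /cderiv.
by rewrite (realC1_derive1 _ _ Hr) (realC1_derive1 _ _ Hi); case: (df x).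
Qed.

Lemma C1_derivP f : C1 f -> C1_deriv f (cderiv f).
Proof.
by move=> [Dr Di Cr Ci]; split; split => // x /=;
  rewrite derive1E; apply: derivableP.
Qed.

Lemma C1_deriv_cst (a : R[i]) : C1_deriv (fun=> a) (fun=> 0).
Proof. by split; exact: realC1_cst. Qed.

Lemma C1_deriv_id : C1_deriv (fun x => x%:C) (fun=> 1).
Proof. by split; [exact: realC1_id | exact: realC1_cst]. Qed.

Lemma C1_derivD f g df dg : C1_deriv f df -> C1_deriv g dg ->
  C1_deriv (fun x => f x + g x) (fun x => df x + dg x).
Proof.
have ReD (a b : R[i]) : Re (a + b) = Re a + Re b by case: a b => [? ?] [].
have ImD (a b : R[i]) : Im (a + b) = Im a + Im b by case: a b => [? ?] [].
move=> [fr fi] [gr gi]; split.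
  by under eq_fun do rewrite ReD; under [X in realC1 _ X]eq_fun do rewrite ReD;
     exact: realC1D.
by under eq_fun do rewrite ImD; under [X in realC1 _ X]eq_fun do rewrite ImD;
   exact: realC1D.
Qed.

Lemma C1_derivM f g df dg : C1_deriv f df -> C1_deriv g dg ->
  C1_deriv (fun x => f x * g x) (fun x => df x * g x + f x * dg x).
Proof.
move=> [fr fi] [gr gi]; split.
  have := realC1D _ _ _ _ (realC1M _ _ _ _ fr gr)
            (realC1N _ _ (realC1M _ _ _ _ fi gi)).
  congr realC1; apply/funext => x; case: (f x) (df x) (g x) (dg x) =>
    [a b] [a' b'] [c e] [c' e'] //=; ring.
have := realC1D _ _ _ _ (realC1M _ _ _ _ fr gi) (realC1M _ _ _ _ fi gr).
congr realC1; apply/funext => x; case: (f x) (df x) (g x) (dg x) =>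
  [a b] [a' b'] [c e] [c' e'] //=; ring.
Qed.

Lemma C1_cst (a : R[i]) : C1 (fun=> a).
Proof. exact: C1_deriv_C1 (C1_deriv_cst a). Qed.

Lemma C1_id : C1 (fun x : R => x%:C).
Proof. exact: C1_deriv_C1 C1_deriv_id. Qed.

Lemma C1D f g : C1 f -> C1 g -> C1 (fun x => f x + g x).
Proof.
by move=> /C1_derivP Hf /C1_derivP Hg; exact: C1_deriv_C1 (C1_derivD _ _ _ _ Hf Hg).
Qed.

Lemma C1M f g : C1 f -> C1 g -> C1 (fun x => f x * g x).
Proof.
by move=> /C1_derivP Hf /C1_derivP Hg; exact: C1_deriv_C1 (C1_derivM _ _ _ _ Hf Hg).
Qed.

Lemma C1X f n : C1 f -> C1 (fun x => f x ^+ n).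
Proof.
move=> Hf; elim: n => [|n IH]; first exact: C1_cst.
by under eq_fun do rewrite exprS; exact: C1M.
Qed.

(** 1/(a + i b) = a/(a^2 + b^2) - i b/(a^2 + b^2), and the denominator vanishes only where [f] does,
    so the real product and inverse rules apply. *)
Lemma C1V f : (forall x, f x != 0) -> C1 f -> C1 (fun x => (f x)^-1).
Proof.
move=> f0 /C1_derivP[fr fi].
have n2 := realC1D _ _ _ _ (realC1M _ _ _ _ fr fr) (realC1M _ _ _ _ fi fi).
have n20 x : Re (f x) * Re (f x) + Im (f x) * Im (f x) != 0.
  move: (f0 x); case: (f x) => a b; apply: contraNneq => /= ab0.
  rewrite eq_complex /=.
  by rewrite -(sqrf_eq0 a) -(sqrf_eq0 b) -paddr_eq0 ?sqr_ge0// !expr2 ab0.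
have n2V := realC1V _ _ n20 n2.
have Hr := realC1M _ _ _ _ fr n2V.
have Hi := realC1N _ _ (realC1M _ _ _ _ fi n2V).
apply: (C1_deriv_C1 _ (fun x => _ +i* _)); split.
  move: Hr; congr realC1; apply/funext => x; case: (f x) => a b /=.
  by rewrite !expr2.
move: Hi; congr realC1; apply/funext => x; case: (f x) => a b /=.
by rewrite !expr2.
Qed.

Lemma normc_le_ReIm (z : R[i]) : normc z <= `|Re z| + `|Im z|.
Proof.
case: z => a b /=; rewrite -(ler_pXn2r (n := 2)) ?nnegrE ?sqrtr_ge0 ?addr_ge0//.
rewrite sqr_sqrtr ?addr_ge0 ?sqr_ge0// sqrrD !real_normK ?num_real//.
by rewrite -addrA lerD2l lerDr mulrn_wge0 ?mulr_ge0.
Qed.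

Lemma continuous_bounded_itv (M : R) f : continuous (fun x => Re (f x)) ->
  continuous (fun x => Im (f x)) ->
  exists2 B, 0 < B & forall x, x \in `[- M, M] -> normc (f x) <= B.
Proof.
move=> cr ci; case: (leP (- M) M) => [MM|MM]; last first.
  exists 1 => // x; rewrite in_itv /= => /andP[a b].
  by move: (lt_le_trans MM (le_trans a b)); rewrite ltxx.
(* The extreme value theorem is applied to |Re f| + |Im f|, a continuous majorant of the modulus. *)
have cn : continuous (fun x => `|Re (f x)| + `|Im (f x)|).
  by move=> x; apply: cvgD; apply: cvg_norm; [exact: cr|exact: ci].
have [//||c _ Hc] := @EVT_max R (fun x => `|Re (f x)| + `|Im (f x)|) (- M) M.
  exact: continuous_subspaceT.
exists (`|Re (f c)| + `|Im (f c)| + 1).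
  by rewrite ltr_wpDl ?addr_ge0.
move=> x /Hc xc; rewrite (le_trans (normc_le_ReIm _)) //.
by rewrite (le_trans xc) // lerDl.
Qed.

Lemma C1_bounded (M : R) f : C1 f ->
  exists2 B, 0 < B & forall x, x \in `[- M, M] ->
    normc (f x) <= B /\ normc (cderiv f x) <= B.
Proof.
move=> /C1_derivP[fr fi].
have [B B0 HB] := continuous_bounded_itv M f
  (realC1_continuous _ _ fr) (realC1_continuous _ _ fi).
have [B' B'0 HB'] := continuous_bounded_itv M (cderiv f) fr.2 fi.2.
exists (B + B') => [|x xM]; first exact: addr_gt0.
by split; [apply: (le_trans (HB _ xM)); rewrite lerDl ltW|
  apply: (le_trans (HB' _ xM)); rewrite lerDr ltW].
Qed.

Lemma sup_norm_on_le (M B : R) f : 0 <= M ->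
  (forall x, x \in `[- M, M] -> normc (f x) <= B) -> sup_norm_on M f <= B.
Proof.
move=> M0 HB; apply: ge_sup.
  by exists (normc (f 0)), 0 => //=; rewrite in_itv /= oppr_le0 M0.
by move=> _ [x xM <-]; exact: HB.
Qed.

(** This is what allows a resolvent, possibly singular outside [-M, M], to be replaced by a C^1
    extension as an argument of [rho]. *)
Lemma restr_eq (M : R) f g : (forall x, x \in `[- M, M] -> f x = g x) ->
  restr M f = restr M g.
Proof.
move=> fg; apply/funext => x; rewrite /restr !patchE; case: ifPn => //.
by rewrite inE /= => /fg.
Qed.

End ComplexC1.

(** * Unordered double sums under geometric bounds *)

Section DoubleSum.
Context {R : realType}.

#[local] Existing Instance totally_filter.

Lemma normc_sum (I : Type) (r : seq I) (p : pred I) (F : I -> R[i]) :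
  normc (\sum_(i <- r | p i) F i) <= \sum_(i <- r | p i) normc (F i).
Proof.
elim/big_rec2: _ => [|i x y _ xy]; first by rewrite normc0.
by rewrite (le_trans (le_normcD _ _)) // lerD2l.
Qed.

Lemma geometric_sum_le (eta : R) n : 0 <= eta < 1 ->
  (1 - eta ^+ n) / (1 - eta) = \sum_(j < n) eta ^+ j /\
  \sum_(j < n) eta ^+ j <= (1 - eta)^-1.
Proof.
move=> /andP[e0 e1]; have e10 : 0 < 1 - eta by rewrite subr_gt0.
have E : (1 - eta ^+ n) / (1 - eta) = \sum_(j < n) eta ^+ j.
  by rewrite -opprB subrX1 -mulNr opprB mulrAC mulfV ?mul1r // gt_eqF.
split=> //; rewrite -E ler_pdivrMr // mulVf ?gt_eqF //.
by rewrite gerBl exprn_ge0.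
Qed.

Let square n : seq (nat * nat) := [seq (j, k) | j <- iota 0 n, k <- iota 0 n].

Let mem_square n (p : nat * nat) : (p \in square n) = (p.1 < n)%N && (p.2 < n)%N.
Proof.
case: p => j k; apply/allpairsP/idP => /= [[[a b]]|/andP[jn kn]].
  by rewrite !mem_iota /= => -[an bn [-> ->]]; apply/andP.
by exists (j, k); rewrite !mem_iota.
Qed.

Let square_uniq n : uniq (square n).
Proof. by apply: allpairs_uniq; rewrite ?iota_uniq // => -[? ?] []. Qed.

Let sum_square (V : zmodType) (F : nat -> nat -> V) n :
  \sum_(p <- square n) F p.1 p.2 = \sum_(j < n) \sum_(k < n) F j k.
Proof.
rewrite big_allpairs -[n in iota 0 n]subn0 big_mkord.
by apply: eq_bigr => j _; rewrite big_mkord.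
Qed.

Let sum_sub_square (V : zmodType) (F : nat * nat -> V) (D : seq (nat * nat)) m :
  uniq D -> {subset D <= square m} ->
  \sum_(p <- D) F p = \sum_(p <- square m | p \in D) F p.
Proof.
move=> uD sD; rewrite -[RHS]big_filter; apply: perm_big.
apply: uniq_perm; rewrite ?filter_uniq // => p; rewrite mem_filter.
by case: (boolP (p \in D)) => //= /sD ->.
Qed.

(** The second bound gives convergence along squares. A finite set containing the n-th square adds
    only terms outside it, and by the first bound these total O(eta^n), uniformly in the set. *)
Lemma has_double_sum_geometric (u : nat -> nat -> R[i]) (s : R[i]) (A B eta : R) :
  0 <= A -> 0 <= B -> 0 <= eta < 1 ->
  (forall j k, normc (u j k) <= A * (eta ^+ j * eta ^+ k)) ->
  (forall n, normc (s - \sum_(j < n) \sum_(k < n) u j k) <= B * eta ^+ n) ->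
  has_double_sum u s.
Proof.
move=> A0 B0 eta01 Hu Hs; have /andP[eta0 eta1] := eta01.
set L := (1 - eta)^-1.
have L0 : 0 <= L by rewrite invr_ge0 subr_ge0 ltW.
(* In the order of [R[i]], 0 < eps forces eps to be real, so estimates are made against [Re eps]. *)
apply/cvgrPdist_le => eps; rewrite ltcE => /andP[/eqP /= eps_im eps0].
(* [L] bounds every partial geometric sum; the terms outside the n-th square contribute at most 2 A
   L^2 eta^n. *)
have [n Hn] : exists n, (B + A * (2 * L ^+ 2)) * eta ^+ n <= Re eps.
  have /cvgrPdist_le /(_ _ eps0) [n _ Hn] :
      geometric (B + A * (2 * L ^+ 2)) eta @ \oo --> 0.
    by apply: cvg_geometric; rewrite ger0_norm.
  exists n; apply: le_trans (Hn n (leqnn n)).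
  by rewrite sub0r normrN /geometric /= ler_norm.
exists (seq_fset tt (square n)) => // D /= sD.
have normE (z : R[i]) : `|z| = (normc z)%:C by [].
rewrite normE lecE /= eps_im eqxx /=.
have -> : partial_sum (fun p => u p.1 p.2) D = \sum_(p <- D) u p.1 p.2.
  by rewrite /partial_sum big_seq_fsetE.
have nD p : p \in square n -> p \in D.
  by move=> pn; apply: (fsubsetP sD); exact: etrans (seq_fsetE tt _ p) pn.
(* A square large enough to contain both [D] and the n-th square. *)
pose m := maxn n (\max_(p <- D) maxn p.1 p.2).+1.
have Dm : {subset (D : seq _) <= square m}.
  move=> p pD; rewrite mem_square -gtn_max; apply: leq_trans (leq_maxr _ _).
  by rewrite ltnS; exact: (leq_bigmax_seq (F := fun p => maxn p.1 p.2) p).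
have nm : {subset square n <= square m}.
  move=> p; rewrite !mem_square => /andP[a b].
  by rewrite !(leq_trans _ (leq_maxl _ _)).
rewrite (sum_sub_square _ _ _ m) ?fset_uniq //.
rewrite (bigID (mem (square n))) /=.
rewrite (eq_bigl (mem (square n))); last first.
  by move=> p /=; case: (boolP (p \in square n)) => [/nD|]; rewrite ?andbT ?andbF.
rewrite -(sum_sub_square _ _ (square n)) // sum_square opprD addrA.
apply: le_trans Hn.
have norm_subc a b : normc (a - b) <= normc a + normc b :> R.
  by rewrite -(normcN b) le_normcD.
apply: (le_trans (norm_subc _ _)); rewrite mulrDl lerD //.
apply: (le_trans (normc_sum _ _ _ _)).
pose G j k := A * (eta ^+ j * eta ^+ k).
have G0 j k : 0 <= G j k by rewrite !mulr_ge0 ?exprn_ge0.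
apply: (@le_trans _ _ (\sum_(p <- square m | p \notin square n) G p.1 p.2)).
  rewrite big_mkcond [leRHS]big_mkcond /=; apply: ler_sum => p _.
  by case: (p \in square n); case: (p \in D) => /=.
have GS k : \sum_(p <- square k) G p.1 p.2 = A * (\sum_(j < k) eta ^+ j) ^+ 2.
  rewrite sum_square expr2 mulr_suml mulr_sumr; apply: eq_bigr => j _.
  by rewrite !mulr_sumr.
have -> : \sum_(p <- square m | p \notin square n) G p.1 p.2 =
    A * (\sum_(j < m) eta ^+ j) ^+ 2 - A * (\sum_(j < n) eta ^+ j) ^+ 2.
  rewrite -!GS (bigID (mem (square n)) xpredT) /=.
  by rewrite -(sum_sub_square _ _ (square n)) // addrAC subrr add0r.
have [_ Sm] := geometric_sum_le eta m eta01.
have [<- _] := geometric_sum_le eta n eta01.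
rewrite -mulrBr -mulrA ler_wpM2l // -/L.
have Sm0 : 0 <= \sum_(j < m) eta ^+ j by apply: sumr_ge0 => j _; rewrite exprn_ge0.
have en0 : 0 <= eta ^+ n by rewrite exprn_ge0.
move: Sm Sm0 en0; rewrite -/L.
move: (\sum_(j < m) _) (eta ^+ n) => S x SL S0 x0.
(* S^2 - ((1 - x) L)^2 <= L^2 (2 x - x^2) <= 2 L^2 x. *)
have : S ^+ 2 <= L ^+ 2 by rewrite ler_pXn2r.
have : 0 <= L ^+ 2 * x ^+ 2 by rewrite mulr_ge0 ?sqr_ge0.
by rewrite exprMn; nra.
Qed.

End DoubleSum.

(** * Geometric decay of derivatives *)

Section Geometric.
Context {R : realType}.
Implicit Types (M : R) (f g q e r : R -> R[i]).

(** The derivative j q^(j-1) q' e + q^j e' is bounded by a multiple of j theta^(j-1) + theta^j, and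
    any ratio eta > theta absorbs the factor j. The induction bounds the function and its derivative
    together. *)
Lemma geometric_C1_bound M (theta eta : R) q e :
  0 <= M -> 0 <= theta -> theta < eta -> C1 q -> C1 e ->
  (forall x, x \in `[- M, M] -> normc (q x) <= theta) ->
  exists2 C, 0 <= C &
    forall j, sup_norm_on M (cderiv (fun x => q x ^+ j * e x)) <= C * eta ^+ j.
Proof.
move=> M0 th0 theta_eta Cq Ce Hq.
have [B1 B10 HB1] := C1_bounded M _ Cq; have [B2 B20 HB2] := C1_bounded M _ Ce.
have d0 : 0 < eta - theta by rewrite subr_gt0.
(* The base case needs B2 <= C; the inductive step, B1 B2 eta^j + theta C eta^j <= C eta^(j+1),
   amounts to B1 B2 <= C (eta - theta). *)
pose C := B2 + B1 * B2 / (eta - theta).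
have CB2 : B2 <= C by rewrite lerDl divr_ge0 ?mulr_ge0 // ltW.
have CB12 : B1 * B2 <= C * (eta - theta).
  by rewrite mulrDl divfK ?gt_eqF // lerDr mulr_ge0 // ltW.
have C0 : 0 <= C by rewrite (le_trans _ CB2) // ltW.
exists C => // j.
suff [da Ha Hb] : exists2 da, C1_deriv (fun x => q x ^+ j * e x) da &
    forall x, x \in `[- M, M] -> normc (q x ^+ j * e x) <= B2 * theta ^+ j /\
      normc (da x) <= C * eta ^+ j.
  by rewrite (C1_deriv_cderiv _ _ Ha); apply: sup_norm_on_le => // x /Hb[].
elim: j => [|j [da Ha IH]].
  exists (cderiv e) => [|x /HB2[h1 h2]].
    by under eq_fun do rewrite expr0 mul1r; exact: C1_derivP.
  by rewrite !expr0 mul1r !mulr1; split=> //; exact: le_trans CB2.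
exists (fun x => cderiv q x * (q x ^+ j * e x) + q x * da x).
  under eq_fun do rewrite exprS -mulrA.
  exact: C1_derivM (C1_derivP _ Cq) Ha.
move=> x xM; have [a1 a2] := IH x xM; have [_ b2] := HB1 x xM.
have nn (z : R[i]) : 0 <= normc z by case: z => ? ? /=; rewrite sqrtr_ge0.
rewrite exprS -mulrA normcM; split.
  by rewrite exprS mulrCA; apply: ler_pM; rewrite ?nn ?Hq.
apply: (le_trans (le_normcD _ _)); rewrite (normcM (cderiv q x)) (normcM (q x) (da x)).
apply: (@le_trans _ _ (B1 * (B2 * theta ^+ j) + theta * (C * eta ^+ j))).
  by apply: lerD; apply: ler_pM; rewrite ?nn ?Hq.
have tj : theta ^+ j <= eta ^+ j.
  by rewrite lerXn2r ?nnegrE // ltW // (le_lt_trans th0).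
have ej : 0 <= eta ^+ j by rewrite exprn_ge0 // ltW // (le_lt_trans th0).
apply: (@le_trans _ _ (B1 * B2 * eta ^+ j + theta * C * eta ^+ j)).
  by rewrite !mulrA lerD2r ler_wpM2l // mulr_ge0 // ltW.
by rewrite exprS; nra.
Qed.

End Geometric.

(** * Bilinearity of [rho] and its geometric expansion *)

Section Acm.
Context {R : realType} (M K : R) (alpha : nat -> nat -> R[i]).
Context (rho : (R -> R[i]) -> (R -> R[i]) -> R[i]).
Hypotheses (M_ge0 : 0 <= M) (K_ge0 : 0 <= K).
Hypothesis Hrho : asymptotic_covariance_map M K alpha rho.
Implicit Types (f g q e r : R -> R[i]).

Let rhor f g := rho (restr M f) (restr M g).

Let C1_itv_restr f : C1 f -> C1_itv M (restr M f).
Proof. by exists f. Qed.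

Let restr_linear (a : R[i]) f g :
  restr M (fun x => a * f x + g x) = (fun x => a * restr M f x + restr M g x).
Proof.
by apply/funext => x; rewrite /restr !patchE; case: ifP => //=; rewrite mulr0 addr0.
Qed.

Lemma acm_addl f1 f2 g : C1 f1 -> C1 f2 -> C1 g ->
  rhor (fun x => f1 x + f2 x) g = rhor f1 g + rhor f2 g.
Proof.
move=> c1 c2 cg; rewrite /rhor -[rho (restr M f1) _]mul1r.
rewrite -(acm_linearl Hrho); try exact: C1_itv_restr.
by rewrite -restr_linear; under [in RHS]eq_fun do rewrite mul1r.
Qed.

Lemma acm_addr f g1 g2 : C1 f -> C1 g1 -> C1 g2 ->
  rhor f (fun x => g1 x + g2 x) = rhor f g1 + rhor f g2.
Proof.
move=> c1 c2 cg; rewrite /rhor -[rho _ (restr M g1)]mul1r.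
rewrite -(acm_linearr Hrho); try exact: C1_itv_restr.
by rewrite -restr_linear; under [in RHS]eq_fun do rewrite mul1r.
Qed.

Lemma acm_scalel (a : R[i]) f g : C1 f -> C1 g ->
  rhor (fun x => a * f x) g = a * rhor f g.
Proof.
move=> cf cg; have c0 : C1 (fun=> 0 : R[i]) := C1_cst 0.
(* [acm_linearl] carries a second summand; taking it to be 0 requires rho(0, g) = 0, which
   additivity gives by cancellation. *)
have r0 : rhor (fun=> 0) g = 0.
  apply: (@addIr _ (rhor (fun=> 0) g)).
  by rewrite -acm_addl // !add0r.
rewrite -[RHS]addr0 -r0 /rhor -(acm_linearl Hrho); try exact: C1_itv_restr.
by rewrite -restr_linear; under [in RHS]eq_fun do rewrite addr0.
Qed.

Lemma acm_scaler (a : R[i]) f g : C1 f -> C1 g ->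
  rhor f (fun x => a * g x) = a * rhor f g.
Proof.
move=> cf cg; have c0 : C1 (fun=> 0 : R[i]) := C1_cst 0.
have r0 : rhor f (fun=> 0) = 0.
  apply: (@addIr _ (rhor f (fun=> 0))).
  by rewrite -acm_addr // !add0r.
rewrite -[RHS]addr0 -r0 /rhor -(acm_linearr Hrho); try exact: C1_itv_restr.
by rewrite -restr_linear; under [in RHS]eq_fun do rewrite addr0.
Qed.

Let normc_ge0 (z : R[i]) : 0 <= normc z.
Proof. by case: z => ? ?; rewrite sqrtr_ge0. Qed.

Lemma acm_bound_le f g (a b : R) : C1 f -> C1 g ->
  sup_norm_on M (cderiv f) <= a -> sup_norm_on M (cderiv g) <= b ->
  normc (rhor f g) <= K * a * b.
Proof.
(* Monotonicity of the product needs nonnegative suprema; [sup] defaults to 0 on a set without a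
   supremum. *)
have s0 (h : R -> R[i]) : 0 <= sup_norm_on M h.
  rewrite /sup_norm_on; have [hS|/sup_out ->//] := pselect (has_sup [set normc (h x) | x in `[- M, M]]).
  have [[_ [x xM _]] ub] := hS.
  by apply: (le_trans (normc_ge0 (h x))); apply: (ub_le_sup ub); exists x.
move=> cf cg fa gb; apply: (le_trans (acm_bound Hrho cf cg)).
by rewrite ler_pM ?mulr_ge0 // ler_wpM2l.
Qed.

(* Iterating [r = e + q r] gives [r = \sum_(j < n) q ^+ j e + q ^+ n r], and the
   derivative of the remainder decays geometrically. *)
Lemma acm_geometric_sum (theta : R) q1 e1 r1 q2 e2 r2 :
  0 <= theta < 1 ->
  C1 q1 -> C1 e1 -> C1 r1 -> C1 q2 -> C1 e2 -> C1 r2 ->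
  (forall x, x \in `[- M, M] -> normc (q1 x) <= theta) ->
  (forall x, x \in `[- M, M] -> normc (q2 x) <= theta) ->
  (forall x, x \in `[- M, M] -> r1 x = e1 x + q1 x * r1 x) ->
  (forall x, x \in `[- M, M] -> r2 x = e2 x + q2 x * r2 x) ->
  has_double_sum
    (fun j k => rhor (fun x => q1 x ^+ j * e1 x) (fun x => q2 x ^+ k * e2 x))
    (rhor r1 r2).
Proof.
move=> /andP[th0 th1] cq1 ce1 cr1 cq2 ce2 cr2 Hq1 Hq2 Hr1 Hr2.
(* The midpoint leaves room above theta for the derivative bounds while staying below 1. *)
pose eta := (theta + 1) / 2.
have theta_eta : theta < eta by rewrite /eta; lra.
have eta01 : 0 <= eta < 1 by rewrite /eta; apply/andP; split; lra.
have [Ce1 Ce10 He1] := geometric_C1_bound _ _ _ _ _ M_ge0 th0 theta_eta cq1 ce1 Hq1.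
have [Cr1 Cr10 Hrem1] := geometric_C1_bound _ _ _ _ _ M_ge0 th0 theta_eta cq1 cr1 Hq1.
have [Ce2 Ce20 He2] := geometric_C1_bound _ _ _ _ _ M_ge0 th0 theta_eta cq2 ce2 Hq2.
have [Cr2 Cr20 Hrem2] := geometric_C1_bound _ _ _ _ _ M_ge0 th0 theta_eta cq2 cr2 Hq2.
have cqe q e j : C1 q -> C1 e -> C1 (fun x => q x ^+ j * e x).
  by move=> cq ce; apply: C1M => //; exact: C1X.
(* [L] stands for [rho] with one argument frozen, so one induction serves both sides. *)
have expand q e r (L : (R -> R[i]) -> R[i]) n : C1 q -> C1 e -> C1 r ->
    (forall x, x \in `[- M, M] -> r x = e x + q x * r x) ->
    (forall f g, C1 f -> C1 g ->
      L (restr M (fun x => f x + g x)) = L (restr M f) + L (restr M g)) ->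
    L (restr M r) = \sum_(j < n) L (restr M (fun x => q x ^+ j * e x)) +
                    L (restr M (fun x => q x ^+ n * r x)).
  move=> cq ce cr Hr HL; elim: n => [|n ->].
    rewrite big_ord0 add0r; congr L; apply: restr_eq => x _.
    by rewrite expr0 mul1r.
  rewrite big_ord_recr /= -addrA; congr (_ + _).
  rewrite -HL; try exact: cqe.
  by congr L; apply: restr_eq => x /Hr {1}->; rewrite exprSr; ring.
have expandl n g : C1 g -> rhor r1 g =
    \sum_(j < n) rhor (fun x => q1 x ^+ j * e1 x) g +
    rhor (fun x => q1 x ^+ n * r1 x) g.
  move=> cg; apply: (expand _ _ _ (fun f => rho f (restr M g))) => // *.
  exact: acm_addl.
have expandr n f : C1 f -> rhor f r2 =
    \sum_(k < n) rhor f (fun x => q2 x ^+ k * e2 x) +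
    rhor f (fun x => q2 x ^+ n * r2 x).
  move=> cf; apply: (expand _ _ _ (fun g => rho (restr M f) g)) => // *.
  exact: acm_addr.
(* The factor 3 counts the remainder terms below, each at most K Cr1 Cr2 eta^n. *)
apply: (has_double_sum_geometric _ _ (K * Ce1 * Ce2)
  (K * Cr1 * Cr2 * 3) eta) => //; try by rewrite !mulr_ge0.
  move=> j k; have := acm_bound_le _ _ _ _ (cqe _ _ j cq1 ce1) (cqe _ _ k cq2 ce2)
    (He1 j) (He2 k).
  by move=> /le_trans; apply; rewrite le_eqVlt; apply/orP; left; apply/eqP; ring.
move=> n.
(* With S_i the truncated sums and A_i = q_i^n r_i = r_i - S_i on [-M, M], bilinearity gives rho(r1,
   r2) - rho(S1, S2) = rho(A1, r2) + rho(r1, A2) - rho(A1, A2). The powers 0 put r1 and r2 in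
   remainder form, so that one bound covers all terms. *)
have -> : rhor r1 r2 - \sum_(j < n) \sum_(k < n)
      rhor (fun x => q1 x ^+ j * e1 x) (fun x => q2 x ^+ k * e2 x) =
    rhor (fun x => q1 x ^+ n * r1 x) (fun x => q2 x ^+ 0 * r2 x) +
    (rhor (fun x => q1 x ^+ 0 * r1 x) (fun x => q2 x ^+ n * r2 x) -
    rhor (fun x => q1 x ^+ n * r1 x) (fun x => q2 x ^+ n * r2 x)).
  under [fun x => q2 x ^+ 0 * _]eq_fun do rewrite expr0 mul1r.
  under [fun x => q1 x ^+ 0 * _]eq_fun do rewrite expr0 mul1r.
  rewrite (expandl n r2) // (expandl n _ (cqe _ _ n cq2 cr2)).
  rewrite (eq_bigr _ (fun (j : 'I_n) _ => expandr n _ (cqe _ _ j cq1 ce1))).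
  by rewrite big_split /=; ring.
have bound a b := acm_bound_le _ _ _ _ (cqe _ _ a cq1 cr1) (cqe _ _ b cq2 cr2)
    (Hrem1 a) (Hrem2 b).
apply: (le_trans (le_normcD _ _)).
have bn0 := bound n 0%N.
apply: (le_trans (lerD bn0 (le_normcD _ _))); rewrite normcN.
apply: (le_trans (lerD (lexx _) (lerD (bound 0%N n) (bound n n)))).
rewrite expr0 !mulr1.
have /andP[eta0 eta1] := eta01.
have en1 : eta ^+ n <= 1 by rewrite exprn_ile1 // ltW.
have en0 : 0 <= eta ^+ n by rewrite exprn_ge0.
have D0 : 0 <= K * Cr1 * Cr2 by rewrite !mulr_ge0.
have : K * Cr1 * Cr2 * (eta ^+ n * eta ^+ n) <= K * Cr1 * Cr2 * eta ^+ n.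
  by rewrite ler_wpM2l // ler_piMl.
nra.
Qed.

End Acm.

(** * Resolvents: C^1 extension and the resolvent identity *)

Section Resolvent.
Context {R : realType}.
Implicit Types (M : R) (z : R[i]).

(* [z - x] may vanish at a real [x] outside [[-M, M]], where an imaginary part
   is added, with the sign of [Im z]. *)
Lemma resolvent_C1_extension M z : 0 <= M -> ~ real_segment M z ->
  exists2 r, C1 r & forall x, x \in `[- M, M] -> r x = resolvent z x.
Proof.
move=> M0 zM; pose s : R := if 0 <= Im z then -1 else 1.
pose b (x : R) : R := s * Num.max 0 (x * x - M * M) ^+ 2.
have [db Hb] : exists db, realC1 b db.
  have sq := realC1D _ _ _ _ (realC1M _ _ _ _ realC1_id realC1_id)
    (realC1_cst (- (M * M))).
  eexists; exact: realC1M _ _ _ _ (realC1_cst s) (realC1_comp _ _ _ _ realC1_sq_max0 sq).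
exists (fun x => (z - (x +i* b x))^-1); last first.
  move=> x; rewrite in_itv /= => /andP[Mx xM]; rewrite /resolvent /b.
  rewrite (_ : Num.max _ _ = 0) ?expr0n ?mulr0 //.
  by apply/max_idPl; nra.
apply: C1V => [x|]; last first.
  have Cb : C1_deriv (fun x => x +i* b x) (fun x => 1 +i* db x).
    by split; [exact: realC1_id | exact: Hb].
  have /C1_deriv_C1 := C1_derivD _ _ _ _ (C1_deriv_cst z)
    (C1_derivM _ _ _ _ (C1_deriv_cst (-1)) Cb).
  by congr C1; apply/funext => x; rewrite mulN1r.
apply/eqP => /eqP; rewrite subr_eq0 => /eqP zx; apply: zM.
have bx : Im z = b x by rewrite zx.
(* The term [- b x] never opposes the sign of [Im z], so Im z = b x forces both to vanish; then x
   lies in [-M, M] and z = x is on the segment. *)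
have [Imz0 max0] : Im z = 0 /\ Num.max 0 (x * x - M * M) = 0.
  have := sqr_ge0 (Num.max 0 (x * x - M * M)).
  move: bx; rewrite /b /s; case: leP => [z0|z0] E m0.
    have m2 : Num.max 0 (x * x - M * M) ^+ 2 = 0 by lra.
    by split; [rewrite E m2 mulr0 | apply/eqP; rewrite -sqrf_eq0 m2].
  by exfalso; lra.
have : x * x - M * M <= 0 by rewrite -max0 le_max lexx orbT.
exists x; first by rewrite /= in_itv /=; apply/andP; split; nra.
by rewrite zx; congr (_ +i* _); rewrite -bx.
Qed.

Lemma notin_real_segment M z : M < normc z -> ~ real_segment M z.
Proof.
move=> Mz [x /=]; rewrite in_itv /= => /andP[Mx xM] zx; move: Mz.
by rewrite -zx /= expr0n /= addr0 sqrtr_sqr ltNge ler_norml Mx xM.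
Qed.

Lemma resolvent_unit M z x : ~ real_segment M z -> x \in `[- M, M] -> z - x%:C != 0.
Proof. by move=> zM xM; apply/eqP => /subr0_eq zx; apply: zM; exists x. Qed.

(** If B bounds |r_z0| on [-M, M], the radius 1/(2 B) gives the ratio 1/2. A point z of the segment
    is then excluded, since (z0 - z) r_z0(x) = 1 at x = z. *)
Lemma resolvent_near M z0 : 0 <= M -> ~ real_segment M z0 ->
  exists2 delta : R, 0 < delta & forall z, normc (z - z0) < delta ->
    ~ real_segment M z /\
    (forall x, x \in `[- M, M] -> normc ((z0 - z) * resolvent z0 x) <= 2^-1).
Proof.
move=> M0 z0M; have [r Cr Hr] := resolvent_C1_extension _ _ M0 z0M.
have [B B0 HB] := C1_bounded M _ Cr.
exists (2 * B)^-1 => [|z zz0]; first by rewrite invr_gt0 mulr_gt0.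
have small x : x \in `[- M, M] -> normc ((z0 - z) * resolvent z0 x) <= 2^-1.
  move=> xM; rewrite normcM -Hr // -opprB normcN.
  apply: (@le_trans _ _ ((2 * B)^-1 * B)); last by rewrite invfM divfK ?gt_eqF.
  apply: ler_pM; [| |exact: ltW|by have [] := HB x xM].
    by case: (z - z0) => ? ?; rewrite sqrtr_ge0.
  by case: (r x) => ? ?; rewrite sqrtr_ge0.
split=> // -[x xM xz]; have := small x xM.
rewrite /resolvent -xz divff ?normc1; last exact: resolvent_unit z0M xM.
by apply/negP; rewrite -ltNge; lra.
Qed.

(** The resolvent identity, in the form r = e + q r with q = (z0 - z) r_z0. *)
Lemma resolvent_geometric M z0 z x : ~ real_segment M z0 -> ~ real_segment M z ->
  x \in `[- M, M] ->
  resolvent z x = resolvent z0 x + (z0 - z) * resolvent z0 x * resolvent z x.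
Proof.
move=> z0M zM xM; rewrite /resolvent.
have := resolvent_unit _ _ _ z0M xM; have := resolvent_unit _ _ _ zM xM.
by move: (x%:C) => y h1 h2; field; rewrite h1 h2.
Qed.

End Resolvent.

(** * Analyticity of rho(r_z, r_w) and its expansion at infinity *)

Section Extension.
Context {R : realType} (M K : R) (alpha : nat -> nat -> R[i]).
Context (rho : (R -> R[i]) -> (R -> R[i]) -> R[i]).
Hypotheses (M_gt0 : 0 < M) (K_ge0 : 0 <= K).
Hypothesis Hrho : asymptotic_covariance_map M K alpha rho.

Let G2 z w := rho (restr M (resolvent z)) (restr M (resolvent w)).

Let M_ge0 : 0 <= M := ltW M_gt0.

Lemma acm_resolvent_analytic z0 w0 :
  ~ real_segment M z0 -> ~ real_segment M w0 -> analytic2_at G2 z0 w0.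
Proof.
move=> z0M w0M.
have [dz dz0 Hz] := resolvent_near _ _ M_ge0 z0M.
have [dw dw0 Hw] := resolvent_near _ _ M_ge0 w0M.
have [rz0 Crz0 Erz0] := resolvent_C1_extension _ _ M_ge0 z0M.
have [rw0 Crw0 Erw0] := resolvent_C1_extension _ _ M_ge0 w0M.
(* The coefficients may not depend on z and w. The signs come from (z0 - z)^j = (-1)^j (z - z0)^j,
   and the factor e = r_z0 raises the power to j + 1. *)
exists (fun j k => (-1) ^+ j * (-1) ^+ k *
  rho (restr M (fun x => rz0 x ^+ j.+1)) (restr M (fun x => rw0 x ^+ k.+1))).
exists (Num.min dz dw); split=> [|z w]; first by rewrite lt_min dz0.
rewrite !lt_min => /andP[/Hz[zM qz] _] /andP[_ /Hw[wM qw]].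
have [rz Crz Erz] := resolvent_C1_extension _ _ M_ge0 zM.
have [rw Crw Erw] := resolvent_C1_extension _ _ M_ge0 wM.
have Cq (a : R[i]) r : C1 r -> C1 (fun x => a * r x).
  by move=> Cr; apply: C1M => //; exact: C1_cst.
have half : 0 <= (2^-1 : R) < 1 by apply/andP; split; lra.
have := acm_geometric_sum _ _ _ _ M_ge0 K_ge0 Hrho _ _ _ _ _ _ _ half
  (Cq (z0 - z) _ Crz0) Crz0 Crz (Cq (w0 - w) _ Crw0) Crw0 Crw.
rewrite /G2 -(restr_eq M _ _ Erz) -(restr_eq M _ _ Erw).
set u := fun j k => rho _ _; set v := fun j k : nat => _ * (w - w0) ^+ k.
have -> : v = u.
  apply/funext => j; apply/funext => k; rewrite /u /v.
  have pow (a b : R[i]) (r : R -> R[i]) n :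
      (fun x => ((b - a) * r x) ^+ n * r x) =
      (fun x => ((-1) ^+ n * (a - b) ^+ n) * r x ^+ n.+1).
    apply/funext => x.
    by rewrite -exprMn mulN1r opprB exprMn exprSr mulrA.
  have Cz : C1 (fun x => rz0 x ^+ j.+1) by exact: C1X.
  have Cw : C1 (fun x => rw0 x ^+ k.+1) by exact: C1X.
  rewrite [RHS](congr2 (fun f g => rho (restr M f) (restr M g))
    (pow z z0 rz0 j) (pow w w0 rw0 k)).
  rewrite (acm_scalel _ _ _ _ Hrho _ _ _ Cz (Cq _ _ Cw)).
  rewrite (acm_scaler _ _ _ _ Hrho _ _ _ Cz Cw).
  by ring.
apply.
- by move=> x xM; rewrite Erz0 // qz.
- by move=> x xM; rewrite Erw0 // qw.
- by move=> x xM; rewrite Erz0 // Erz //; exact: resolvent_geometric xM.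
- by move=> x xM; rewrite Erw0 // Erw //; exact: resolvent_geometric xM.
Qed.

Let acm_sub_constl (a : R[i]) f g : C1 f -> C1 g ->
  rho (restr M (fun x => a + f x)) (restr M g) = rho (restr M f) (restr M g).
Proof.
move=> Cf Cg; rewrite (acm_addl _ _ _ _ Hrho) //; last exact: C1_cst.
have -> : (fun=> a) = (fun x : R => a * (fun=> 1) x).
  by apply/funext => x; rewrite mulr1.
rewrite (acm_scalel _ _ _ _ Hrho) //; last exact: C1_cst.
by rewrite (acm_1l Hrho) ?mulr0 ?add0r //; exists g.
Qed.

Let acm_sub_constr (a : R[i]) f g : C1 f -> C1 g ->
  rho (restr M f) (restr M (fun x => a + g x)) = rho (restr M f) (restr M g).
Proof.
move=> Cf Cg; rewrite (acm_addr _ _ _ _ Hrho) //; last exact: C1_cst.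
have -> : (fun=> a) = (fun x : R => a * (fun=> 1) x).
  by apply/funext => x; rewrite mulr1.
rewrite (acm_scaler _ _ _ _ Hrho) //; last exact: C1_cst.
by rewrite (acm_1r Hrho) ?mulr0 ?add0r //; exists f.
Qed.

(* The constant [z^-1] is removed from [resolvent z], since [rho] vanishes on
   constants; the rest [s] satisfies [s = x / z ^+ 2 + (x / z) * s]. *)
Lemma acm_resolvent_second_order_cauchy z w :
  M < normc z -> M < normc w -> second_order_cauchy alpha z w (G2 z w).
Proof.
move=> Mz Mw.
have zM := notin_real_segment _ _ Mz; have wM := notin_real_segment _ _ Mw.
have [rz Crz Erz] := resolvent_C1_extension _ _ M_ge0 zM.
have [rw Crw Erw] := resolvent_C1_extension _ _ M_ge0 wM.
have nz0 (y : R[i]) : M < normc y -> y != 0.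
  by apply: contraTneq => ->; rewrite normc0 -leNgt.
have Cx (a : R[i]) : C1 (fun x => x%:C * a).
  by apply: C1M; [exact: C1_id | exact: C1_cst].
have Cs (a : R[i]) r : C1 r -> C1 (fun x => x%:C * a * r x).
  by move=> Cr; exact: C1M.
have split_const (y : R[i]) r : M < normc y -> ~ real_segment M y ->
    (forall x, x \in `[- M, M] -> r x = resolvent y x) ->
    forall x, x \in `[- M, M] -> resolvent y x = y^-1 + x%:C * y^-1 * r x.
  move=> /nz0 y0 yM Er x xM; rewrite Er // /resolvent.
  have := resolvent_unit _ _ _ yM xM.
  by move: (x%:C) => t h; field; rewrite h y0.
have G2E : G2 z w = rho (restr M (fun x => x%:C * z^-1 * rz x))
                        (restr M (fun x => x%:C * w^-1 * rw x)).
  rewrite /G2 (restr_eq M _ _ (split_const _ _ Mz zM Erz)).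
  rewrite (restr_eq M _ _ (split_const _ _ Mw wM Erw)).
  apply: etrans (acm_sub_constl z^-1 _ _ (Cs _ _ Crz) _) _.
    by apply: C1D; [exact: C1_cst | exact: Cs].
  exact: acm_sub_constr w^-1 _ _ (Cs _ _ Crz) (Cs _ _ Crw).
rewrite /second_order_cauchy G2E.
(* The geometric expansion takes one ratio for both variables, hence the larger of the two. *)
pose theta := Num.max (M / normc z) (M / normc w).
have gt0 (y : R[i]) : M < normc y -> 0 < normc y by exact: lt_trans.
have theta01 : 0 <= theta < 1.
  rewrite le_max gt_max !ltr_pdivrMr ?mul1r ?Mz ?Mw ?gt0 //.
  by rewrite divr_ge0 // ltW // gt0.
have bnd (y : R[i]) x : M < normc y -> x \in `[- M, M] ->
    normc (x%:C * y^-1) <= M / normc y.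
  move=> My; rewrite in_itv /= => xM; rewrite normcM normcV ler_pM2r ?invr_gt0 ?gt0 //.
  by rewrite /= expr0n /= addr0 sqrtr_sqr ler_norml.
have rec (y : R[i]) r : M < normc y -> ~ real_segment M y ->
    (forall x, x \in `[- M, M] -> r x = resolvent y x) ->
    forall x, x \in `[- M, M] -> x%:C * y^-1 * r x =
      x%:C * (y^-1 * y^-1) + x%:C * y^-1 * (x%:C * y^-1 * r x).
  move=> My yM Er x xM; rewrite [in LHS]Er // (split_const _ _ My yM Er) //.
  by ring.
have := acm_geometric_sum _ _ _ _ M_ge0 K_ge0 Hrho _ _ _ _ _ _ _ theta01
  (Cx z^-1) (Cx (z^-1 * z^-1)) (Cs z^-1 _ Crz)
  (Cx w^-1) (Cx (w^-1 * w^-1)) (Cs w^-1 _ Crw).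
set u := fun j k => rho _ _; set v := fun j k : nat => _ / _.
have -> : v = u.
  apply/funext => j; apply/funext => k; rewrite /u /v.
  (* With the constant removed, the n-th term is x^(n+1)/y^(n+2): exponents start at 1, as in the
     series for G_2. *)
  have pow (y : R[i]) n : (fun x => (x%:C * y^-1) ^+ n * (x%:C * (y^-1 * y^-1))) =
      (fun x : R => (y ^+ n.+2)^-1 * x%:C ^+ n.+1).
    apply/funext => x; rewrite exprMn -exprVn !exprS; ring.
  have CX n : C1 (fun x : R => x%:C ^+ n.+1) by apply: C1X; exact: C1_id.
  rewrite [RHS](congr2 (fun f g => rho (restr M f) (restr M g)) (pow z j) (pow w k)).
  rewrite (acm_scalel _ _ _ _ Hrho _ _ _ (CX j) (C1M _ _ (C1_cst _) (CX k))).
  rewrite (acm_scaler _ _ _ _ Hrho _ _ _ (CX j) (CX k)).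
  by rewrite (acm_monomials Hrho) // invfM; ring.
apply.
- by move=> x xM; rewrite (le_trans (bnd _ _ Mz xM)) // le_max lexx.
- by move=> x xM; rewrite (le_trans (bnd _ _ Mw xM)) // le_max lexx orbT.
- exact: rec.
- exact: rec.
Qed.

End Extension.

(** * The second-order Cauchy transform of the ensemble *)

Theorem theorem10 (R : realType)
    (d : nat -> measure_display) (T : forall N : nat, measurableType (d N))
    (P : forall N : nat, probability (T N) R)
    (X : forall N : nat, T N -> 'M[R[i]]_N)
    (HX : forall N : nat, selfadjoint_random_matrix (P N) (X N))
    (M K : R) (M_gt0 : 0 < M) (K_gt0 : 0 < K)
    (alpha1 : nat -> R[i]) (alpha2 : nat -> nat -> R[i])
    (Halpha1 : forall n : nat,
      (fun N : nat => N%:R^-1 * cexpectation (P N) (fun t => \tr (X N t ^+ n)))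
        @ \oo --> alpha1 n)
    (Halpha2 : forall m n : nat,
      (fun N : nat => ccovariance (P N) (fun t => \tr (X N t ^+ m))
                                        (fun t => \tr (X N t ^+ n)))
        @ \oo --> alpha2 m n)
    (Htail :
      (fun N : nat => (((N%:R : R) ^+ 8)%:E *
                       P N [set t | (M < opnorm (X N t))%R])%E)
        @ \oo --> 0%E)
    (Hvar : forall (f : R -> R[i]) (N : nat), C1 f ->
      (cvariance (P N) (fun t => trace_fun f (X N t))
         <= K%:E * sup_norm (cderiv f) ^+ 2)%E)
    (rho : (R -> R[i]) -> (R -> R[i]) -> R[i])
    (Hrho : asymptotic_covariance_map M K alpha2 rho) :
  exists G2 : R[i] -> R[i] -> R[i],
    [/\ forall z w : R[i], M < normc z -> M < normc w ->
          second_order_cauchy alpha2 z w (G2 z w),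
        forall z w : R[i], ~ real_segment M z -> ~ real_segment M w ->
          analytic2_at G2 z w &
        forall z w : R[i], Im z != 0 -> Im w != 0 ->
          G2 z w = rho (restr M (resolvent z)) (restr M (resolvent w))].
Proof.
(* One formula serves on the whole domain, so the identity for non-real z and w is reflexivity; the
   series and analyticity remain. *)
exists (fun z w => rho (restr M (resolvent z)) (restr M (resolvent w))).
split=> // [z w Mz Mw|z w zM wM].
  exact: acm_resolvent_second_order_cauchy M_gt0 (ltW K_gt0) Hrho _ _ Mz Mw.
exact: acm_resolvent_analytic M_gt0 (ltW K_gt0) Hrho _ _ zM wM.
Qed.
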